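(* Let $d\ge2$ and $n=\lfloor d/2\rfloor$. For $k\ge2$ let $I_k\subset\mathbb{R}[\lambda_1,\dots,\lambda_d]$ be the ideal generated by $v_2(2\pi),\dots,v_k(2\pi)$, and let the Bautin ideal be $I=\bigcup_{k\ge2}I_k$ (the ideal generated by all $v_k(2\pi)$, $k\ge2$). Then $I=(\lambda_2,\lambda_4,\dots,\lambda_{2n})$, and the Bautin index $B$, defined as the smallest integer $k\ge2$ such that $I_j=I_k$ for all $j\ge k$, equals $2n+1$.
   Context: Let $\lambda=(\lambda_1,\dots,\lambda_d)$ be real parameters, and $p(x)=\sum_{i=1}^d\lambda_i x^i$. Consider the planar Liénard system $\dot x=y$, $\dot y=-x+p(x)y$. In polar coordinates $x=r\cos\theta$, $y=r\sin\theta$ its orbits satisfy $$\frac{dr}{d\theta}=\frac{r\,p(r\cos\theta)\sin^2\theta}{-1+\sin\theta\cos\theta\,p(r\cos\theta)}.$$ For small $r_0$ let $r(\theta;r_0)$ be the solution of this equation with $r(0;r_0)=r_0$. For each $\theta$, the map $r_0\mapsto r(\theta;r_0)$ is analytic near $0$ and tangent to the identity, and its inverse has the expansion $r_0=r+\sum_{k\ge2}v_k(\theta)r^k$ where $r=r(\theta;r_0)$. Each $v_k(\theta)$ is a polynomial in $\lambda$ with real coefficients depending on $\theta$; the $v_k(2\pi)$ are the coefficients of (the inverse of) the first return mapping. *)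

(* Defs.v *)
From Stdlib Require Import Reals.
From Coquelicot Require Import Coquelicot.
From mathcomp Require Import all_boot all_algebra.
From mathcomp Require Import Rstruct.
From mathcomp Require Import mpoly.

Set Implicit Arguments.
Unset Strict Implicit.
Unset Printing Implicit Defensive.

(* lam : 'I_d -> R encodes (lambda_1, ..., lambda_d): lambda_{i+1} = lam i. *)

Definition pL (d : nat) (lam : 'I_d -> R) (x : R) : R :=
  (\sum_(i < d) lam i * x ^+ i.+1)%R.

Definition polarF (d : nat) (lam : 'I_d -> R) (th r : R) : R :=
  (r * pL lam (r * cos th) * (sin th) ^ 2
     / (-1 + sin th * cos th * pL lam (r * cos th)))%R.

(* [inv_return_coeff lam k c]: c = v_k(2 pi) at parameter lam, i.e. c is the
   k-th Taylor coefficient at 0 of the inverse h of the map r0 |-> r(2 pi; r0),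
   where r(theta; r0) solves dr/dtheta = polarF with r(0; r0) = r0. *)
Definition inv_return_coeff (d : nat) (lam : 'I_d -> R) (k : nat) (c : R) : Prop :=
  exists (delta : R) (phi : R -> R -> R) (h : R -> R),
    (0 < delta)%R /\
    (forall r0, (Rabs r0 < delta)%R ->
        phi 0%R r0 = r0 /\
        forall th, (0 <= th <= 2 * PI)%R ->
          is_derive (fun t => phi t r0) th (polarF lam th (phi th r0))) /\
    (forall r0, (Rabs r0 < delta)%R -> h (phi (2 * PI)%R r0) = r0) /\
    c = (Derive_n h k 0 / INR (k`!))%R.

Local Open Scope ring_scope.

(* the variable lambda_{i+1}, i.e. 'X_i, as a polynomial (0 if i >= d) *)
Definition lamX (d : nat) (i : nat) : {mpoly R[d]} :=
  if @insub nat (fun j => j < d)%N 'I_d i is Some o then 'X_o else 0.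

Definition ideal_gen (d : nat) (gs : seq {mpoly R[d]}) (p : {mpoly R[d]}) : Prop :=
  exists cs : seq {mpoly R[d]},
    size cs = size gs /\ p = \sum_(i < size gs) cs`_i * gs`_i.

Definition I_k (d : nat) (V : nat -> {mpoly R[d]}) (k : nat) (p : {mpoly R[d]}) : Prop :=
  ideal_gen [seq V j | j <- iota 2 (k - 1)] p.

Definition Bautin_ideal (d : nat) (V : nat -> {mpoly R[d]}) (p : {mpoly R[d]}) : Prop :=
  exists k, (2 <= k)%N /\ I_k V k p.

Definition stabilizes_from (d : nat) (V : nat -> {mpoly R[d]}) (k : nat) : Prop :=
  forall j, (k <= j)%N -> forall p, I_k V j p <-> I_k V k p.

Definition is_Bautin_index (d : nat) (V : nat -> {mpoly R[d]}) (B : nat) : Prop :=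
  (2 <= B)%N /\ stabilizes_from V B /\
  forall k, (2 <= k)%N -> (k < B)%N -> ~ stabilizes_from V k.

(* generators lambda_2, lambda_4, ..., lambda_{2n}, n = d/2 (lambda_{2j} = 'X_(2j-1)) *)
Definition even_gens (d : nat) : seq {mpoly R[d]} :=
  [seq lamX d (2 * j).+1 | j <- iota 0 d./2].

(* Main.v *)
Require Import Defs.
From Stdlib Require Import Reals Lra Lia.
From Coquelicot Require Import Coquelicot.

(** The series [H(t, r) = sum_k v_k(t) r^k] is a first integral of the polar
    equation, [H_t + H_r F = 0], which after clearing the denominator becomes
      [v_k' = sum_i lambda_i c^i (s c v_{k-i}' + s^2 (k - i) v_{k-i})],
    with [c = cos t], [s = sin t], [v_1 = 1] and [v_k(0) = 0] for [k >= 2].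
    By induction [|v_k(t)| <= C^(k-1) e^((k-1)|t|)], so [H] converges for small
    [r]; its level curves are the orbits, and [H(2 PI, .)] is the inverse of the
    return map.

    Give [lambda_i] weight [i].  Then [v_k] is homogeneous of weight [k - 1], and
    its coefficient functions satisfy the same recursion.  If no even [lambda]
    occurs in a monomial, the reversibility [t -> PI - t] makes its coefficient
    [2 PI]-periodic, so it vanishes at [2 PI].  The coefficient of [lambda_2j] in
    [v_{2j+1}(2 PI)] is the integral of [c^(2j) s^2], which is positive.  Hence
    [I_k] is generated by the [lambda_2j] with [2j <= k - 1] and [j <= n]. *)

Open Scope R_scope.

(** * Series depending on a parameter *)

Lemma continuity_pt_is_derive (f : R -> R) (x l : R) :
  is_derive f x l -> continuity_pt f x.
Proof.
  intros H. apply continuity_pt_filterlim.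
  apply (ex_derive_continuous (V := R_NormedModule)). now exists l.
Qed.

(** Weierstrass M-test: by the mean value inequality [M] also bounds the difference quotients, so
    both tails are small uniformly in [h] and only a finite sum is left to differentiate. *)
Lemma is_derive_Series (u du : nat -> R -> R) (M : nat -> R) (x e : R) :
  0 < e ->
  (forall n t, Rabs (t - x) < e -> is_derive (u n) t (du n t)) ->
  (forall n t, Rabs (t - x) < e -> Rabs (du n t) <= M n) ->
  ex_series M ->
  (forall t, Rabs (t - x) < e -> ex_series (fun n => u n t)) ->
  is_derive (fun t => Series (fun n => u n t)) x (Series (fun n => du n x)).
Proof.
  intros He Hu Hdu HM Hex.
  assert (Hx : Rabs (x - x) < e) by (rewrite Rminus_diag, Rabs_R0; exact He).
  assert (M0 : forall n, 0 <= M n)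
    by (intros n; apply Rle_trans with (2 := Hdu n x Hx), Rabs_pos).
  apply is_derive_Reals. intros eps Heps.
  (* The error has three thirds: a finite sum, the tail of the quotients and the tail of the
     derivatives. [N] is positive because the finite sum runs up to [pred N]. *)
  assert (Htail : exists N, (0 < N)%nat /\
                   Series (fun k => M (N + k)%nat) < eps / 3).
  { destruct HM as [l Hl].
    assert (Hl' := Hl).
    apply is_series_Reals in Hl'. destruct (Hl' (eps / 3)) as [N HN]; [lra|].
    exists (S N). split; [lia|].
    specialize (HN N (Nat.le_refl N)). unfold Rdist in HN.
    rewrite <- (is_series_unique _ _ Hl) in HN.
    rewrite (Series_incr_n M (S N)) in HN; [|lia|now exists l].
    simpl pred in HN. apply Rabs_def2 in HN. lra. }
  destruct Htail as [N [HN0 HN]].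
  assert (Hfin : is_derive (fun t => sum_n (fun k => u k t) (pred N)) x
                   (sum_n (fun k => du k x) (pred N))).
  { apply (is_derive_sum_n (V := R_NormedModule)). intros k _. now apply Hu. }
  apply is_derive_Reals in Hfin.
  destruct (Hfin (eps / 3)) as [dl Hdl]; [lra|].
  assert (Hm : 0 < Rmin dl e) by (apply Rmin_pos; [apply cond_pos|exact He]).
  exists (mkposreal _ Hm). simpl. intros h Hh0 Hh.
  assert (Hh1 : Rabs h < dl) by (apply Rlt_le_trans with (1 := Hh), Rmin_l).
  assert (Hh2 : Rabs h < e) by (apply Rlt_le_trans with (1 := Hh), Rmin_r).
  assert (Hxh : Rabs (x + h - x) < e)
    by (replace (x + h - x) with h by ring; exact Hh2).
  specialize (Hdl h Hh0 Hh1).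
  rewrite !sum_n_Reals in Hdl.
  assert (Hq : forall n, Rabs ((u n (x + h) - u n x) / h) <= M n).
  { intros n.
    assert (B : Rabs (u n (x + h) - u n x) <= M n * Rabs (x + h - x)).
    { apply bounded_variation with (dh := du n). intros t Ht.
      assert (Ht' : Rabs (t - x) < e)
        by (apply Rle_lt_trans with (1 := Ht); exact Hxh).
      split; [now apply Hu|now apply Hdu]. }
    replace (x + h - x) with h in B by ring.
    unfold Rdiv. rewrite Rabs_mult, Rabs_inv.
    apply Rmult_le_reg_r with (Rabs h); [now apply Rabs_pos_lt|].
    rewrite Rmult_assoc, Rinv_l, Rmult_1_r; [exact B|now apply Rabs_no_R0]. }
  pose (w := fun n => (u n (x + h) - u n x) / h - du n x).
  assert (exq : ex_series (fun n => (u n (x + h) - u n x) / h)).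
  { apply (ex_series_le (V := R_CompleteNormedModule)) with M; [|exact HM].
    exact Hq. }
  assert (exdu : ex_series (fun n => du n x)).
  { apply (ex_series_le (V := R_CompleteNormedModule)) with M; [|exact HM].
    intros n. now apply Hdu. }
  assert (E : (Series (fun n => u n (x + h)) - Series (fun n => u n x)) / h
              - Series (fun n => du n x) = Series w).
  { unfold w. rewrite (Series_minus (fun n => (u n (x + h) - u n x) / h)) by assumption.
    f_equal. unfold Rdiv. rewrite Series_scal_r. f_equal.
    symmetry. apply Series_minus; auto. }
  rewrite E.
  assert (exw : ex_series w) by (apply (ex_series_minus (V := R_NormedModule)); assumption).
  rewrite (Series_incr_n w N HN0 exw).
  assert (F : sum_f_R0 w (pred N) =
    (sum_f_R0 (fun k => u k (x + h)) (pred N) - sum_f_R0 (fun k => u k x) (pred N)) / h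
    - sum_f_R0 (fun k => du k x) (pred N)).
  { unfold w. clear - Hh0.
    induction (pred N) as [|n IH]; simpl; [reflexivity|].
    rewrite IH. field. exact Hh0. }
  rewrite F.
  assert (exMN : ex_series (fun k => M (N + k)%nat)) by now apply ex_series_incr_n.
  assert (exM2 : ex_series (fun k => 2 * M (N + k)%nat))
    by exact (ex_series_scal (V := R_NormedModule) 2 _ exMN).
  assert (W : forall n, Rabs (w n) <= 2 * M n).
  { intros n. unfold w. apply Rle_trans with (1 := Rabs_triang _ _).
    rewrite Rabs_Ropp. specialize (Hq n). specialize (Hdu n x Hx). lra. }
  assert (G : Rabs (Series (fun k => w (N + k)%nat)) <= 2 * Series (fun k => M (N + k)%nat)).
  { apply Rle_trans with (Series (fun k => Rabs (w (N + k)%nat))).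
    - apply Series_Rabs.
      apply (ex_series_le (V := R_CompleteNormedModule)) with (2 := exM2).
      intros n. unfold norm; simpl. unfold abs; simpl. rewrite Rabs_Rabsolu. apply W.
    - rewrite <- Series_scal_l. apply Series_le; [|exact exM2].
      intros n. split; [apply Rabs_pos|apply W]. }
  apply Rle_lt_trans with (1 := Rabs_triang _ _). lra.
Qed.

Lemma PSeries_le_dominated (a b : nat -> R) (x rho : R) :
  (forall k, Rabs (a k) <= b k) -> Rabs x <= rho ->
  Rbar_lt rho (CV_radius b) ->
  Rabs (PSeries a x) <= PSeries b rho.
Proof.
  intros Hab Hx Hrho.
  assert (rho0 : 0 <= rho) by (apply Rle_trans with (2 := Hx), Rabs_pos).
  assert (D : forall n, Rabs (a n * x ^ n) <= b n * rho ^ n).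
  { intros n. rewrite Rabs_mult, <- RPow_abs.
    apply Rmult_le_compat; auto using Rabs_pos.
    apply pow_le, Rabs_pos. apply pow_incr. split; [apply Rabs_pos|exact Hx]. }
  assert (E : ex_series (fun n => b n * rho ^ n)).
  { apply ex_pseries_R, CV_radius_inside. now rewrite Rabs_pos_eq. }
  unfold PSeries. apply Rle_trans with (Series (fun n => Rabs (a n * x ^ n))).
  - apply Series_Rabs.
    apply (ex_series_le (V := R_CompleteNormedModule)) with (2 := E).
    intros n. unfold norm; simpl. unfold abs; simpl. rewrite Rabs_Rabsolu. apply D.
  - apply Series_le; [|exact E]. intros n; split; [apply Rabs_pos|apply D].
Qed.

Lemma CV_radius_geom_le (a : nat -> R) (c M x : R) :
  0 < M -> (forall k, Rabs (a k) <= c * M ^ k) -> Rabs x < / M ->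
  Rbar_lt (Rabs x) (CV_radius a).
Proof.
  intros HM Ha Hx.
  apply Rbar_lt_le_trans with (/ M); [exact Hx|].
  destruct (CV_radius_bounded a) as [ub _]. apply ub.
  exists c. intros n. rewrite Rabs_mult, (Rabs_pos_eq ((/ M) ^ n)).
  - apply Rle_trans with (c * M ^ n * (/ M) ^ n).
    + apply Rmult_le_compat_r; [|apply Ha].
      apply pow_le, Rlt_le, Rinv_0_lt_compat, HM.
    + rewrite Rmult_assoc, <- Rpow_mult_distr, Rinv_r, pow1; lra.
  - apply pow_le, Rlt_le, Rinv_0_lt_compat, HM.
Qed.

Lemma PS_derive_le_dominated (a b : nat -> R) :
  (forall k, Rabs (a k) <= b k) ->
  forall k, Rabs (PS_derive a k) <= PS_derive b k.
Proof.
  intros H k. unfold PS_derive. rewrite Rabs_mult, (Rabs_pos_eq (INR _)) by apply pos_INR.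
  apply Rmult_le_compat_l; [apply pos_INR|apply H].
Qed.

(** * Power series in r whose coefficients depend on t *)

Section AnalyticFamily.

Variables (v dv : nat -> R -> R) (M T : R).
Hypothesis M_gt0 : 0 < M.
Hypothesis v_derive : forall k t, is_derive (v k) t (dv k t).
Hypothesis v_le : forall k t, Rabs t < T -> Rabs (v k t) <= M ^ k.
Hypothesis dv_le : forall k t, Rabs t < T -> Rabs (dv k t) <= M ^ k.

(** Half of the guaranteed radius: the closed disc of radius [rho] lies strictly inside the disc of
    convergence of the majorant [M ^ k] and of its derivatives. *)
Let rho := / (2 * M).

Lemma rho_lt : 0 < rho < / M.
Proof.
  unfold rho. split; [apply Rinv_0_lt_compat; lra|].
  apply Rinv_0_lt_contravar; lra.
Qed.

Lemma CV_radius_v t x : Rabs t < T -> Rabs x <= rho ->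
  Rbar_lt (Rabs x) (CV_radius (fun k => v k t)).
Proof.
  intros Ht Hx. apply (CV_radius_geom_le _ 1 M); auto.
  - intros k. rewrite Rmult_1_l. now apply v_le.
  - destruct rho_lt; lra.
Qed.

Lemma CV_radius_dv t x : Rabs t < T -> Rabs x <= rho ->
  Rbar_lt (Rabs x) (CV_radius (fun k => dv k t)).
Proof.
  intros Ht Hx. apply (CV_radius_geom_le _ 1 M); auto.
  - intros k. rewrite Rmult_1_l. now apply dv_le.
  - destruct rho_lt; lra.
Qed.

Lemma CV_radius_pow c : Rbar_lt rho (CV_radius (fun k => c * M ^ k)).
Proof.
  rewrite <- (Rabs_pos_eq rho) by (destruct rho_lt; lra).
  apply (CV_radius_geom_le _ (Rabs c) M); auto.
  - intros k. rewrite Rabs_mult, (Rabs_pos_eq (M ^ k)); [lra|].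
    apply pow_le; lra.
  - rewrite (Rabs_pos_eq rho) by (destruct rho_lt; lra). apply rho_lt.
Qed.

Lemma is_derive_PSeries_param t x : Rabs t < T -> Rabs x <= rho ->
  is_derive (fun s => PSeries (fun k => v k s) x) t (PSeries (fun k => dv k t) x).
Proof.
  intros Ht Hx.
  assert (Hs : forall s, Rabs (s - t) < T - Rabs t -> Rabs s < T).
  { intros s Hs. replace s with (s - t + t) by ring.
    apply Rle_lt_trans with (1 := Rabs_triang _ _). lra. }
  unfold PSeries.
  apply (is_derive_Series (fun k s => v k s * x ^ k) (fun k s => dv k s * x ^ k)
          (fun k => M ^ k * Rabs x ^ k) t (T - Rabs t)).
  - lra.
  - intros n s Hst.
    replace (dv n s * x ^ n) with (scal (dv n s) (x ^ n)) by reflexivity.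
    apply (is_derive_scal_l (V := R_NormedModule)), v_derive.
  - intros n s Hst. rewrite Rabs_mult, <- RPow_abs.
    apply Rmult_le_compat_r; [apply pow_le, Rabs_pos|apply dv_le; auto].
  - apply ex_series_ext with (fun k => (M * Rabs x) ^ k).
    { intros n. apply Rpow_mult_distr. }
    apply ex_series_geom. rewrite Rabs_pos_eq.
    + apply Rlt_le_trans with (M * / M); [|rewrite Rinv_r; lra].
      apply Rmult_lt_compat_l; [exact M_gt0|destruct rho_lt; lra].
    + apply Rmult_le_pos; [lra|apply Rabs_pos].
  - intros s Hst. apply ex_pseries_R, CV_radius_inside, CV_radius_v; auto.
Qed.

(** The estimates consumed by the implicit function argument: H_t is bounded and H_r is Lipschitz in
    each variable. Each constant comes from the geometric majorant, or one of its derivatives, at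
    [rho]. *)
Lemma PSeries_param_bounds : exists K, 0 < K /\
  (forall t x, Rabs t < T -> Rabs x <= rho ->
     Rabs (PSeries (fun k => dv k t) x) <= K) /\
  (forall t x y, Rabs t < T -> Rabs x <= rho -> Rabs y <= rho ->
     Rabs (PSeries (PS_derive (fun k => v k t)) x
           - PSeries (PS_derive (fun k => v k t)) y) <= K * Rabs (x - y)) /\
  (forall t s x, Rabs t < T -> Rabs s < T -> Rabs x <= rho ->
     Rabs (PSeries (PS_derive (fun k => v k t)) x
           - PSeries (PS_derive (fun k => v k s)) x) <= K * Rabs (t - s)).
Proof.
  pose (b := fun k => 1 * M ^ k).
  pose (K0 := PSeries b rho).
  pose (K1 := PSeries (PS_derive (PS_derive b)) rho).
  pose (K2 := PSeries (PS_derive b) rho).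
  assert (P0 : forall t x, Rabs t < T -> Rabs x <= rho ->
     Rabs (PSeries (fun k => dv k t) x) <= K0).
  { intros t x Ht Hx. apply PSeries_le_dominated; [|exact Hx|apply CV_radius_pow].
    intros k. unfold b. rewrite Rmult_1_l. now apply dv_le. }
  assert (P1 : forall t x y, Rabs t < T -> Rabs x <= rho -> Rabs y <= rho ->
     Rabs (PSeries (PS_derive (fun k => v k t)) x
           - PSeries (PS_derive (fun k => v k t)) y) <= K1 * Rabs (x - y)).
  { intros t x y Ht Hx Hy.
    destruct (MVT_gen (PSeries (PS_derive (fun k => v k t))) y x
       (PSeries (PS_derive (PS_derive (fun k => v k t))))) as [c [Hc E]].
    - intros c Hc. apply is_derive_PSeries. rewrite CV_radius_derive.
      apply CV_radius_v; auto.
      revert Hc Hx Hy. unfold Rmin, Rmax, Rabs.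
      destruct (Rle_dec y x); repeat destruct Rcase_abs; lra.
    - intros c Hc. apply PSeries_continuity. rewrite CV_radius_derive.
      apply CV_radius_v; auto.
      revert Hc Hx Hy. unfold Rmin, Rmax, Rabs.
      destruct (Rle_dec y x); repeat destruct Rcase_abs; lra.
    - rewrite E, Rabs_mult. apply Rmult_le_compat_r; [apply Rabs_pos|].
      unfold K1. apply PSeries_le_dominated.
      + apply PS_derive_le_dominated, PS_derive_le_dominated.
        intros k. unfold b. rewrite Rmult_1_l. now apply v_le.
      + revert Hc Hx Hy. unfold Rmin, Rmax, Rabs.
        destruct (Rle_dec y x); repeat destruct Rcase_abs; lra.
      + rewrite !CV_radius_derive. apply CV_radius_pow. }
  assert (P2 : forall t s x, Rabs t < T -> Rabs s < T -> Rabs x <= rho ->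
     Rabs (PSeries (PS_derive (fun k => v k t)) x
           - PSeries (PS_derive (fun k => v k s)) x) <= K2 * Rabs (t - s)).
  { intros t s x Ht Hs Hx.
    assert (D : forall k, Rabs (v k t - v k s) <= Rabs (t - s) * M ^ k).
    { intros k. rewrite Rmult_comm.
      destruct (MVT_gen (v k) s t (dv k)) as [c [Hc E]].
      - intros; apply v_derive.
      - intros c _. apply continuity_pt_is_derive with (dv k c), v_derive.
      - rewrite E, Rabs_mult. apply Rmult_le_compat_r; [apply Rabs_pos|].
        apply dv_le. revert Hc Ht Hs. unfold Rmin, Rmax, Rabs.
        destruct (Rle_dec s t); repeat destruct Rcase_abs; lra. }
    rewrite <- PSeries_minus.
    2: apply ex_pseries_derive, CV_radius_v; auto.
    2: apply ex_pseries_derive, CV_radius_v; auto.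
    rewrite (PSeries_ext _ (PS_derive (fun k => v k t - v k s))).
    2: { intros n. unfold PS_minus, PS_plus, PS_opp, PS_derive, plus, opp; simpl. ring. }
    apply Rle_trans with (PSeries (PS_derive (fun k => Rabs (t - s) * M ^ k)) rho).
    - apply PSeries_le_dominated; auto.
      + apply PS_derive_le_dominated, D.
      + rewrite CV_radius_derive. apply CV_radius_pow.
    - right. unfold K2. rewrite Rmult_comm, <- PSeries_scal.
      apply PSeries_ext. intros n. unfold PS_scal, PS_derive, b, scal; simpl.
      unfold mult; simpl. ring. }
  exists (1 + Rabs K0 + Rabs K1 + Rabs K2).
  assert (H0 := Rabs_pos K0). assert (H1 := Rabs_pos K1). assert (H2 := Rabs_pos K2).
  assert (L0 := Rle_abs K0). assert (L1 := Rle_abs K1). assert (L2 := Rle_abs K2).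
  repeat split.
  - lra.
  - intros t x Ht Hx. specialize (P0 t x Ht Hx). lra.
  - intros t x y Ht Hx Hy. apply Rle_trans with (1 := P1 t x y Ht Hx Hy).
    apply Rmult_le_compat_r; [apply Rabs_pos|lra].
  - intros t s x Ht Hs Hx. apply Rle_trans with (1 := P2 t s x Ht Hs Hx).
    apply Rmult_le_compat_r; [apply Rabs_pos|lra].
Qed.

End AnalyticFamily.

(** * Implicit functions *)

Lemma Rabs_between (x y c b : R) :
  Rmin x y <= c <= Rmax x y -> Rabs x <= b -> Rabs y <= b -> Rabs c <= b.
Proof.
  unfold Rmin, Rmax, Rabs. destruct (Rle_dec x y); repeat destruct Rcase_abs; lra.
Qed.

Lemma Rabs_sub_between (x y c : R) :
  Rmin x y <= c <= Rmax x y -> Rabs (c - x) <= Rabs (y - x).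
Proof.
  unfold Rmin, Rmax, Rabs. destruct (Rle_dec x y); repeat destruct Rcase_abs; lra.
Qed.

Section ImplicitFunction.

Variables (H Hr Ht : R -> R -> R) (T rho K : R).
Hypotheses (rho_gt0 : 0 < rho) (K_gt0 : 0 < K).
Hypothesis H_derive_r : forall t r, Rabs t < T -> Rabs r <= rho ->
  is_derive (H t) r (Hr t r).
Hypothesis H_derive_t : forall t r, Rabs t < T -> Rabs r <= rho ->
  is_derive (fun s => H s r) t (Ht t r).
Hypothesis Ht_le : forall t r, Rabs t < T -> Rabs r <= rho -> Rabs (Ht t r) <= K.
Hypothesis Hr_lip_r : forall t x y, Rabs t < T -> Rabs x <= rho -> Rabs y <= rho ->
  Rabs (Hr t x - Hr t y) <= K * Rabs (x - y).
Hypothesis Hr_lip_t : forall t s x, Rabs t < T -> Rabs s < T -> Rabs x <= rho ->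
  Rabs (Hr t x - Hr s x) <= K * Rabs (t - s).
Hypothesis H0 : forall t, H t 0 = 0.
Hypothesis Hr0 : forall t, Hr t 0 = 1.

(** Since [Hr t 0 = 1] and [Hr t] is [K]-Lipschitz, [K * rho' <= / 2] keeps [Hr] at least 1/2 on
    this disc. *)
Let rho' := Rmin rho (/ (2 * K)).

Lemma implicit_radius : 0 < rho' /\ rho' <= rho /\ K * rho' <= / 2.
Proof.
  assert (0 < / (2 * K)) by (apply Rinv_0_lt_compat; lra).
  split; [now apply Rmin_pos|]. split; [apply Rmin_l|].
  apply Rle_trans with (K * / (2 * K)).
  - apply Rmult_le_compat_l; [lra|apply Rmin_r].
  - right. field. lra.
Qed.

Lemma Hr_ge t r : Rabs t < T -> Rabs r <= rho' -> / 2 <= Hr t r.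
Proof.
  intros Htt Hrr. destruct implicit_radius as [A [B C]].
  assert (L := Hr_lip_r t r 0 Htt).
  rewrite Rabs_R0, Hr0, Rminus_0_r in L.
  assert (L' := L ltac:(lra) ltac:(lra)).
  assert (K * Rabs r <= K * rho') by (apply Rmult_le_compat_l; lra).
  apply Rcomplements.Rabs_le_between in L'. lra.
Qed.

Lemma H_MVT t x y : Rabs t < T -> Rabs x <= rho' -> Rabs y <= rho' ->
  exists c, Rabs c <= rho' /\ Rabs (c - x) <= Rabs (y - x) /\
    H t y - H t x = Hr t c * (y - x).
Proof.
  intros Htt Hx Hy. destruct implicit_radius as [A [B C]].
  destruct (MVT_gen (H t) x y (Hr t)) as [c [Hc E]].
  - intros c Hc. apply H_derive_r; auto.
    apply Rle_trans with rho'; auto. apply (Rabs_between x y); auto; lra.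
  - intros c Hc. apply continuity_pt_is_derive with (Hr t c).
    apply H_derive_r; auto.
    apply Rle_trans with rho'; auto. apply (Rabs_between x y); auto; lra.
  - exists c. split; [now apply (Rabs_between x y)|].
    split; [now apply Rabs_sub_between|exact E].
Qed.

(** The slope of [H t] is at least 1/2, so its inverse is 2-Lipschitz. This yields uniqueness of the
    level point and a Lipschitz bound on the level curve. *)
Lemma H_expand t x y : Rabs t < T -> Rabs x <= rho' -> Rabs y <= rho' ->
  Rabs (y - x) <= 2 * Rabs (H t y - H t x).
Proof.
  intros Htt Hx Hy. destruct (H_MVT t x y Htt Hx Hy) as [c [Hc [_ E]]].
  rewrite E, Rabs_mult. assert (G := Hr_ge t c Htt Hc).
  rewrite (Rabs_pos_eq (Hr t c)) by lra.
  assert (P := Rabs_pos (y - x)). nra.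
Qed.

(** At the ends of the interval [H t] reaches at least [rho' / 2] in absolute value, so the
    intermediate value theorem applies. The domain conditions sit inside a sigma type so that its
    projection is a total function. *)
Lemma implicit_solution t r0 :
  {r | Rabs t < T -> Rabs r0 < rho' / 2 -> Rabs r <= rho' /\ H t r = r0}.
Proof.
  destruct (Rlt_dec (Rabs t) T) as [Htt|]; [|exists 0; tauto].
  destruct (Rlt_dec (Rabs r0) (rho' / 2)) as [Hr0'|]; [|exists 0; tauto].
  destruct implicit_radius as [A [B C]].
  assert (Ab : forall b, - rho' <= b <= rho' -> Rabs b <= rho')
    by (intros b Hb; apply Rcomplements.Rabs_le_between; lra).
  assert (P : rho' <= 2 * H t rho').
  { destruct (H_MVT t 0 rho' Htt) as [c [Hc [_ E]]]; try (apply Ab; lra).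
    rewrite H0 in E. assert (G := Hr_ge t c Htt Hc). nra. }
  assert (Q : 2 * H t (- rho') <= - rho').
  { destruct (H_MVT t 0 (- rho') Htt) as [c [Hc [_ E]]]; try (apply Ab; lra).
    rewrite H0 in E. assert (G := Hr_ge t c Htt Hc). nra. }
  apply Rabs_def2 in Hr0'.
  destruct (Ranalysis5.IVT_interv (fun r => H t r - r0) (- rho') rho') as [z [Hz E]].
  - intros a Ha. apply continuity_pt_minus.
    + apply continuity_pt_is_derive with (Hr t a), H_derive_r; auto.
      apply Rle_trans with rho'; auto.
    + apply continuity_pt_const. intros x y; reflexivity.
  - lra.
  - lra.
  - lra.
  - exists z. intros _ _. split; [apply Ab; lra|lra].
Qed.

(** Implicit differentiation of [H t (phi t r0) = r0]. The uniqueness clause serves to identify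
    [phi] at the initial angle. *)
Lemma implicit_function : exists (delta : R) (phi : R -> R -> R),
  0 < delta /\
  forall t r0, Rabs t < T -> Rabs r0 < delta ->
    Rabs (phi t r0) <= rho /\ H t (phi t r0) = r0 /\ / 2 <= Hr t (phi t r0) /\
    (forall r, Rabs r < delta -> H t r = r0 -> phi t r0 = r) /\
    is_derive (fun s => phi s r0) t (- Ht t (phi t r0) / Hr t (phi t r0)).
Proof.
  destruct implicit_radius as [A [B C]].
  exists (rho' / 2), (fun t r0 => proj1_sig (implicit_solution t r0)).
  split; [lra|]. intros t r0 Htt Hr0'.
  assert (S : forall s, Rabs s < T ->
     Rabs (proj1_sig (implicit_solution s r0)) <= rho' /\
     H s (proj1_sig (implicit_solution s r0)) = r0).
  { intros s Hs. destruct (implicit_solution s r0) as [z Hz]; simpl. now apply Hz. }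
  set (f := fun s => proj1_sig (implicit_solution s r0)) in *.
  change (proj1_sig (implicit_solution t r0)) with (f t).
  destruct (S t Htt) as [S1 S2]. fold (f t) in S1, S2.
  split; [lra|]. split; [exact S2|]. split; [now apply Hr_ge|]. split.
  { intros r Hrr E. assert (G := H_expand t r (f t) Htt).
    rewrite S2, E, Rminus_diag, Rabs_R0 in G.
    assert (G' := G ltac:(lra) S1). assert (P := Rabs_pos (f t - r)).
    assert (P0 : Rabs (f t - r) = 0) by lra.
    destruct (Req_dec (f t - r) 0) as [Z|Z]; [lra|].
    now apply Rabs_no_R0 in Z. }
  set (x := f t) in *.
  assert (lo := Hr_ge t x Htt S1).
  apply is_derive_Reals. intros eps Heps.
  assert (D := H_derive_t t x Htt ltac:(lra)).
  apply is_derive_Reals in D.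
  destruct (D (eps / 8)) as [d1 Hd1]; [lra|].
  (* Below, [K * (1 + 2 * K)] bounds the change of [Hr] along the curve per unit of [h], and [2 * K]
     bounds the quotient [p]. *)
  pose (K' := K * (1 + 2 * K) * (2 * K)).
  assert (K'0 : 0 < K') by (unfold K'; repeat apply Rmult_lt_0_compat; lra).
  pose (d2 := Rmin (T - Rabs t) (eps / (8 * K'))).
  assert (d2_gt0 : 0 < d2).
  { apply Rmin_pos; [lra|]. apply Rdiv_lt_0_compat; lra. }
  assert (d_gt0 : 0 < Rmin d1 d2) by (apply Rmin_pos; [apply cond_pos|exact d2_gt0]).
  exists (mkposreal _ d_gt0). simpl. intros h h0 Hh.
  assert (h1 : Rabs h < d1) by (apply Rlt_le_trans with (1 := Hh), Rmin_l).
  assert (h2 : Rabs h < d2) by (apply Rlt_le_trans with (1 := Hh), Rmin_r).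
  assert (h3 : Rabs h < T - Rabs t) by (apply Rlt_le_trans with (1 := h2), Rmin_l).
  assert (h4 : Rabs h < eps / (8 * K')) by (apply Rlt_le_trans with (1 := h2), Rmin_r).
  assert (Hs : Rabs (t + h) < T)
    by (apply Rle_lt_trans with (1 := Rabs_triang _ _); lra).
  destruct (S (t + h) Hs) as [S3 S4]. fold (f (t + h)) in S3, S4.
  set (y := f (t + h)) in *.
  specialize (Hd1 h h0 h1).
  set (q := (H (t + h) x - H t x) / h) in *.
  assert (Eq : H (t + h) x - H t x = q * h) by (unfold q; field; exact h0).
  (* At fixed [x] the level moves by at most [K * Rabs h], and the inverse of [H (t + h)] is
     2-Lipschitz. *)
  assert (Lip : Rabs (y - x) <= 2 * K * Rabs h).
  { assert (G := H_expand (t + h) x y Hs S1 S3).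
    rewrite S4 in G. rewrite <- S2 in G.
    replace (H t x - H (t + h) x) with (- (H (t + h) x - H t x)) in G by ring.
    rewrite Rabs_Ropp in G.
    assert (BV : Rabs (H (t + h) x - H t x) <= K * Rabs (t + h - t)).
    { apply (bounded_variation (fun s => H s x) (fun s => Ht s x)). intros s Hst.
      replace (t + h - t) with h in Hst by ring.
      assert (Rabs s < T).
      { replace s with (s - t + t) by ring.
        apply Rle_lt_trans with (1 := Rabs_triang _ _). lra. }
      split; [apply H_derive_t|apply Ht_le]; lra. }
    replace (t + h - t) with h in BV by ring. lra. }
  destruct (H_MVT (t + h) x y Hs S1 S3) as [c [Hc [Hcx E]]].
  rewrite S4 in E. rewrite <- S2 in E.
  set (a := Hr (t + h) c) in *. set (b := Hr t x) in *. set (l := Ht t x) in *.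
  assert (Eab : Rabs (a - b) <= K * (1 + 2 * K) * Rabs h).
  { replace (a - b) with ((Hr (t + h) c - Hr (t + h) x) + (Hr (t + h) x - Hr t x))
      by (unfold a, b; ring).
    apply Rle_trans with (1 := Rabs_triang _ _).
    assert (E1 := Hr_lip_r (t + h) c x Hs ltac:(lra) ltac:(lra)).
    assert (E2 := Hr_lip_t (t + h) t x Hs Htt ltac:(lra)).
    replace (t + h - t) with h in E2 by ring.
    assert (K * Rabs (c - x) <= K * (2 * K * Rabs h))
      by (apply Rmult_le_compat_l; lra).
    lra. }
  set (p := (y - x) / h).
  assert (Ep : y - x = p * h) by (unfold p; field; exact h0).
  assert (Hp : Rabs p <= 2 * K).
  { rewrite Ep, Rabs_mult in Lip. apply Rmult_le_reg_r with (2 := Lip).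
    now apply Rabs_pos_lt. }
  (* Both points lie on level [r0], so the increments of [H] in [t] and in [r] cancel. *)
  assert (Eap : a * p = - q).
  { apply Rmult_eq_reg_r with h; [|exact h0].
    rewrite Rmult_assoc, <- Ep, <- E. lra. }
  change (Rabs (p - - l / b) < eps).
  replace (p - - l / b) with ((- (a - b) * p - (q - l)) / b).
  2: { field_simplify_eq; [|lra]. rewrite <- Ropp_mult_distr_l.
       replace q with (- (a * p)) by lra. ring. }
  unfold Rdiv. rewrite Rabs_mult.
  assert (N1 : Rabs (- (a - b) * p - (q - l)) < eps / 4).
  { apply Rle_lt_trans with (1 := Rabs_triang _ _).
    rewrite Rabs_Ropp, Rabs_mult, Rabs_Ropp.
    assert (Rabs (a - b) * Rabs p <= K * (1 + 2 * K) * Rabs h * (2 * K))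
      by (apply Rmult_le_compat; auto using Rabs_pos).
    assert (K' * Rabs h < eps / 8).
    { apply Rlt_le_trans with (K' * (eps / (8 * K'))).
      - now apply Rmult_lt_compat_l.
      - right. field. lra. }
    unfold K' in *. lra. }
  assert (N2 : 0 < Rabs (/ b) <= 2).
  { rewrite Rabs_pos_eq by (apply Rlt_le, Rinv_0_lt_compat; lra).
    split; [apply Rinv_0_lt_compat; lra|].
    rewrite <- (Rinv_inv 2). apply Rinv_le_contravar; lra. }
  assert (P := Rabs_pos (- (a - b) * p - (q - l))). nra.
Qed.

End ImplicitFunction.

(** * Calculus of one variable *)

(** Both [A * exp (a * t) - f t] and [A * exp (a * t) + f t] start at [A >= 0] and have nonnegative
    derivative. *)
Lemma Rabs_le_exp_of_derive_nonneg (f df : R -> R) (a A : R) :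
  0 <= a -> 0 <= A ->
  (forall t, is_derive f t (df t)) -> f 0 = 0 ->
  (forall t, Rabs (df t) <= a * (A * exp (a * Rabs t))) ->
  forall t, 0 <= t -> Rabs (f t) <= A * exp (a * t).
Proof.
  intros a0 A0 Hf f0 Hdf t t0.
  assert (G : forall e, Rabs e = 1 -> e * f t <= A * exp (a * t)).
  { intros e He.
    destruct (MVT_gen (fun s => A * exp (a * s) - e * f s) 0 t
      (fun s => a * (A * exp (a * s)) - e * df s)) as [c [Hc E]].
    - intros s _. auto_derive; [eexists; apply Hf|].
      replace (Derive (fun x : R => f x) s) with (df s)
        by (symmetry; apply is_derive_unique, Hf). ring.
    - intros s _. apply continuity_pt_is_derive with (a * (A * exp (a * s)) - e * df s).
      auto_derive; [eexists; apply Hf|].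
      replace (Derive (fun x : R => f x) s) with (df s)
        by (symmetry; apply is_derive_unique, Hf). ring.
    - rewrite Rmin_left, Rmax_right in Hc by lra.
      rewrite f0, Rmult_0_r, exp_0 in E.
      specialize (Hdf c). rewrite (Rabs_pos_eq c) in Hdf by lra.
      assert (e * df c <= a * (A * exp (a * c))).
      { apply Rle_trans with (2 := Hdf). apply Rle_trans with (1 := Rle_abs _).
        rewrite Rabs_mult, He. lra. }
      assert (0 <= (a * (A * exp (a * c)) - e * df c) * (t - 0))
        by (apply Rmult_le_pos; lra).
      lra. }
  apply Rcomplements.Rabs_le_between. split.
  - assert (X := G (-1)). rewrite Rabs_left in X by lra. specialize (X ltac:(lra)). lra.
  - assert (X := G 1). rewrite Rabs_R1 in X. specialize (X eq_refl). lra.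
Qed.

Lemma Rabs_le_exp_of_derive (f df : R -> R) (a A : R) :
  0 <= a -> 0 <= A ->
  (forall t, is_derive f t (df t)) -> f 0 = 0 ->
  (forall t, Rabs (df t) <= a * (A * exp (a * Rabs t))) ->
  forall t, Rabs (f t) <= A * exp (a * Rabs t).
Proof.
  intros a0 A0 Hf f0 Hdf t. destruct (Rle_dec 0 t) as [t0|t0].
  - rewrite (Rabs_pos_eq t t0). now apply Rabs_le_exp_of_derive_nonneg with df.
  - rewrite (Rabs_left t) by lra.
    assert (X := Rabs_le_exp_of_derive_nonneg (fun s => f (- s)) (fun s => - df (- s)) a A).
    simpl in X. replace t with (- - t) at 1 by ring. apply X; auto.
    + intros s. auto_derive; [eexists; apply Hf|].
      replace (Derive (fun x : R => f x) (- s)) with (df (- s))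
        by (symmetry; apply is_derive_unique, Hf). ring.
    + now rewrite Ropp_0.
    + intros s. rewrite Rabs_Ropp, <- (Rabs_Ropp s). apply Hdf.
    + lra.
Qed.

Lemma eq_derive0 (f : R -> R) (x y : R) : (forall t, is_derive f t 0) -> f x = f y.
Proof.
  intros Hf.
  destruct (MVT_gen f x y (fun _ => 0) (fun t _ => Hf t)
    (fun t _ => continuity_pt_is_derive _ _ _ (Hf t))) as [c [_ E]].
  lra.
Qed.

Lemma is_derive_comp_sub (f df : R -> R) (a t : R) :
  (forall s, is_derive f s (df s)) ->
  is_derive (fun s => f (a - s)) t (- df (a - t)).
Proof.
  intros Hf. auto_derive; [eexists; apply Hf|].
  replace (Derive (fun x : R => f x) (a + - t)) with (df (a - t))
    by (symmetry; apply is_derive_unique, Hf). ring.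
Qed.

Lemma is_derive_comp_add (f df : R -> R) (a t : R) :
  (forall s, is_derive f s (df s)) ->
  is_derive (fun s => f (s + a)) t (df (t + a)).
Proof.
  intros Hf. auto_derive; [eexists; apply Hf|].
  replace (Derive (fun x : R => f x) (t + a)) with (df (t + a))
    by (symmetry; apply is_derive_unique, Hf). ring.
Qed.

Lemma trig_reversible (t : R) :
  cos (PI - t) = - cos t /\ sin (PI - t) = sin t /\
  cos (t + 2 * PI) = cos t /\ sin (t + 2 * PI) = sin t.
Proof.
  replace (PI - t) with (- t + PI) by ring.
  rewrite neg_cos, neg_sin, cos_neg, sin_neg, cos_plus, sin_plus, cos_2PI, sin_2PI.
  repeat split; ring.
Qed.

(** The integrand is nonnegative, and strictly positive on the open quarter period at which the
    integral is split. *)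
Lemma RInt_cos_sin2_gt0 (n : nat) :
  0 < RInt (fun t => cos t ^ (2 * n) * sin t ^ 2) 0 (2 * PI).
Proof.
  set (f := fun t => cos t ^ (2 * n) * sin t ^ 2).
  assert (cf : forall t, continuous f t).
  { intros t. apply (ex_derive_continuous (V := R_NormedModule)).
    unfold f. auto_derive. exact I. }
  assert (If : forall a b, ex_RInt f a b)
    by (intros a b; apply (ex_RInt_continuous (V := R_CompleteNormedModule)); intros; apply cf).
  assert (P := PI_RGT_0).
  rewrite <- (RInt_Chasles f 0 (PI / 2) (2 * PI)) by apply If.
  apply Rplus_lt_le_0_compat.
  - apply RInt_gt_0; [lra| |intros; apply cf].
    intros t Ht. apply Rmult_lt_0_compat; apply pow_lt.
    + apply cos_gt_0; lra.
    + apply sin_gt_0; lra.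
  - apply RInt_ge_0; [lra|apply If|]. intros t _. apply Rmult_le_pos.
    + rewrite pow_mult. apply pow_le, pow2_ge_0.
    + apply pow2_ge_0.
Qed.

Close Scope R_scope.

From mathcomp Require Import all_boot all_order all_algebra.
From mathcomp Require Import Rstruct mpoly.
From mathcomp Require Import zify ring lra.

Set Implicit Arguments.
Unset Strict Implicit.
Unset Printing Implicit Defensive.

Import Order.TTheory GRing.Theory Num.Theory.
Delimit Scope R_scope with coqR.
Local Open Scope ring_scope.

(** * The first integral *)

Lemma is_pseries_sum (I : Type) (s : seq I) (A : I -> nat -> R) (x : R) (l : I -> R) :
  (forall i, is_pseries (A i) x (l i)) ->
  is_pseries (fun k => \sum_(i <- s) A i k) x (\sum_(i <- s) l i).
Proof.
move=> HA; elim: s => [|i s IHs].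
  rewrite big_nil.
  apply: (filterlim_ext (fun=> zero)); last exact: filterlim_const.
  move=> n; rewrite /sum_n (sum_n_m_ext _ (fun=> zero)) ?sum_n_m_const_zero //.
  by move=> k; rewrite big_nil; exact: scal_zero_r.
rewrite big_cons.
apply: (is_pseries_ext (PS_plus (A i) (fun k => \sum_(j <- s) A j k))).
  by move=> n; rewrite big_cons.
exact: is_pseries_plus.
Qed.

Section FirstIntegral.

Variables (d : nat) (lam : 'I_d -> R) (v dv : nat -> R -> R).
Hypothesis v_derive : forall k t, is_derive (v k) t (dv k t).
Hypothesis v0 : forall t, v 0%N t = 0.
Hypothesis v1 : forall t, v 1%N t = 1.
Hypothesis v_init : forall k, (2 <= k)%N -> v k 0 = 0.
(** The ordinal [i] stands for the subscript [i + 1], hence the shifts by [i.+1]. The guard keeps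
    the subtraction from truncating and makes [dv 0] vanish. *)
Hypothesis dvE : forall k t, dv k t =
  \sum_(i < d | (i < k)%N) lam i * cos t ^+ i.+1 *
    (sin t * cos t * dv (k - i.+1) t + sin t ^+ 2 * ((k - i.+1)%:R * v (k - i.+1) t)).

Let L := \sum_(i < d) `|lam i|.
(** [2 * L] pays for the two terms of the recursion, and the added 1 makes the powers of [C]
    nondecreasing. *)
Let C := 1 + 2 * L.

(** * Exponential bounds on the coefficients *)

Lemma L_ge0 : 0 <= L. Proof. exact: sumr_ge0. Qed.

Lemma C_ge1 : 1 <= C. Proof. by have := L_ge0; rewrite /C; lra. Qed.

Lemma normr_cos_le1 t : `|cos t| <= 1.
Proof. by have [/RleP h1 /RleP h2] := COS_bound t; rewrite ler_norml h1 h2. Qed.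

Lemma normr_sin_le1 t : `|sin t| <= 1.
Proof. by have [/RleP h1 /RleP h2] := SIN_bound t; rewrite ler_norml h1 h2. Qed.

Lemma exp_leP (x y : R) : x <= y -> exp x <= exp y.
Proof.
rewrite le_eqVlt => /orP[/eqP->//|/RltP h].
exact/ltW/RltP/exp_increasing.
Qed.

(* The factor [k - i] in the recursion costs a power of [k] at each step; the
   exponential weight gives it back on integration. *)
Let bound (k : nat) (t : R) := C ^+ k.-1 * exp (k.-1%:R * `|t|)%R.

Lemma bound_ge0 k t : 0 <= bound k t.
Proof.
rewrite mulr_ge0 ?exprn_ge0 ?(le_trans _ C_ge1) //.
exact/ltW/RltP/exp_pos.
Qed.

Lemma boundS_le j k t : (j < k)%N -> C * bound j.+1 t <= bound k.+1 t.
Proof.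
move=> jk; rewrite /bound /= mulrA -exprS; apply: ler_pM.
- by rewrite exprn_ge0 ?(le_trans _ C_ge1).
- exact/ltW/RltP/exp_pos.
- by rewrite ler_weXn2l ?C_ge1.
- by apply: exp_leP; rewrite ler_wpM2r // ler_nat ltnW.
Qed.

(** A lower index gains a factor [C] in [bound]. It is kept on the left so that the sum over [i]
    only has to compare [2 * L] with [C]. *)
Lemma dv_term_le k t (i : 'I_d) : (i < k)%N ->
  (forall j, (j < k)%N -> `|dv j t| <= j.-1%:R * bound j t /\ `|v j t| <= bound j t) ->
  `|lam i * cos t ^+ i.+1 *
    (sin t * cos t * dv (k - i.+1) t + sin t ^+ 2 * ((k - i.+1)%:R * v (k - i.+1) t))|
  * C <= `|lam i| * (2 * (k.-1%:R * bound k t)).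
Proof.
move=> ik IH.
have dv0 : dv 0%N t = 0 by rewrite dvE big_pred0.
have c0 := le_trans ler01 C_ge1.
case Ej: (k - i.+1)%N => [|j].
  (* At index 0 both terms vanish, the second through its factor [k - i.+1]. *)
  rewrite dv0 !mulr0 mul0r mulr0 addr0 mulr0 normr0 mul0r.
  by rewrite 3?mulr_ge0 ?bound_ge0.
have jk : (j.+1 < k)%N by lia.
case: k => [//|k] in ik IH Ej jk *.
have [IH1 IH2] := IH _ jk.
have := boundS_le t (jk : (j < k)%N); have := bound_ge0 j.+1 t.
have -> : k.+1.-1 = k by [].
move: (bound j.+1 t) (bound k.+1 t) IH1 IH2 => b b' IH1 IH2 b0 B.
rewrite normrM normrM -[X in X <= _]mulrA -[X in X <= _]mulrA ler_wpM2l //.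
rewrite normrX; apply: (@le_trans _ _ (2 * (k%:R * b) * C)); last first.
  by rewrite -!mulrA ler_wpM2l // ler_wpM2l // mulrC.
rewrite mulrA ler_wpM2r // -[X in _ <= X]mul1r; apply: ler_pM => //.
- by rewrite exprn_ge0.
- by rewrite exprn_ile1 ?normr_cos_le1.
have s1 := normr_sin_le1 t; have c1 := normr_cos_le1 t.
apply: (le_trans (ler_normD _ _)); rewrite [X in _ <= X]mulr_natl mulr2n; apply: lerD.
  rewrite normrM -[X in _ <= X]mul1r ler_pM // ?normrM ?mulr_ile1 //.
  by rewrite (le_trans IH1) // ler_wpM2r // ler_nat /=; lia.
rewrite normrM -[X in _ <= X]mul1r ler_pM // ?normrX ?exprn_ile1 //.
by rewrite normrM normr_nat ler_pM // ler_nat; lia.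
Qed.

(** The bound on [dv k] is the derivative of the exponential majorant with respect to the absolute
    value of [t], so integrating it returns the bound on [v k]. *)
Lemma v_dv_le k t : `|dv k t| <= k.-1%:R * bound k t /\ `|v k t| <= bound k t.
Proof.
elim/ltn_ind: k t => k IH t.
have Hdv s : `|dv k s| <= k.-1%:R * bound k s.
  have Cgt0 : 0 < C := lt_le_trans ltr01 C_ge1.
  rewrite -(ler_pM2r Cgt0) dvE.
  apply: (@le_trans _ _ (L * (2 * (k.-1%:R * bound k s)))).
    apply: (@le_trans _ _ (\sum_(i < d | (i < k)%N) `|lam i| * (2 * (k.-1%:R * bound k s)))).
      apply: le_trans (ler_wpM2r (ltW Cgt0) (ler_norm_sum _ _ _)) _.
      rewrite mulr_suml; apply: ler_sum => i ik.
      by apply: dv_term_le => // j jk; exact: IH.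
    rewrite [X in _ <= X]mulr_suml [X in _ <= X](bigID (fun i : 'I_d => (i < k)%N)) /= lerDl.
    by apply: sumr_ge0 => i _; rewrite 3?mulr_ge0 ?bound_ge0.
  have B : 0 <= k.-1%:R * bound k s by rewrite 1?mulr_ge0 ?bound_ge0.
  have L0 := L_ge0; rewrite mulrA [X in _ <= X]mulrC ler_wpM2r // /C; lra.
split=> //.
(* Indices 0 and 1 are settled directly: [v 1] is 1 at the origin, while the comparison lemma needs
   initial value 0. *)
case: k => [|[|k]] in IH Hdv *.
- by rewrite v0 normr0 bound_ge0.
- by rewrite v1 normr1 /bound /= mulr0n mul0r exp_0 mulr1.
have := @Rabs_le_exp_of_derive (v k.+2) (dv k.+2) k.+1%:R (C ^+ k.+1).
rewrite /bound /= => X.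
have : (Rabs (v k.+2 t) <= C ^+ k.+1 * exp (k.+1%:R * Rabs t)%coqR)%coqR.
  apply: X => //.
  - exact/RleP.
  - by apply/RleP; rewrite exprn_ge0 ?(le_trans _ C_ge1).
  - exact: v_init.
  - by move=> s; apply/RleP; exact: Hdv.
by move/RleP.
Qed.

(* Any bound on [`|t|] larger than [2 * PI] would do in place of [9]. *)
Lemma v_dv_geometric : exists M : R, [/\ 0 < M,
  (forall k t, `|t| < 9 -> `|v k t| <= M ^+ k) &
  (forall k t, `|t| < 9 -> `|dv k t| <= M ^+ k)].
Proof.
(* The factor 2 absorbs [k.-1 <= 2 ^ k] in the bound on the derivative. *)
pose M := 2 * (C * exp 9%:R).
have e1 : 1 <= exp 9%:R by have := exp_leP (ler0n R 9); rewrite exp_0.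
have Ce1 : 1 <= C * exp 9%:R by rewrite (le_trans C_ge1) // ler_peMr // (le_trans _ C_ge1).
have key k t : `|t| < 9 -> bound k t <= (C * exp 9%:R) ^+ k.
  move=> t8; apply: (@le_trans _ _ ((C * exp 9%:R) ^+ k.-1)); last first.
    by apply: ler_weXn2l; rewrite ?leq_pred.
  rewrite exprMn ler_wpM2l ?exprn_ge0 ?(le_trans _ C_ge1) //.
  have -> : exp 9%:R ^+ k.-1 = exp (k.-1%:R * 9%:R)%R.
    elim: k.-1 => [|n IHn]; first by rewrite mul0r exp_0.
    by rewrite exprS IHn -RmultE -exp_plus; congr exp; rewrite RplusE; ring.
  by apply: exp_leP; rewrite ler_wpM2l // ltW.
have k2 k : k.-1%:R <= 2 ^+ k :> R.
  by rewrite -natrX ler_nat (leq_trans (leq_pred _)) // ltnW // ltn_expl.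
exists M; split.
- by rewrite /M; lra.
- move=> k t t8; have [_ h] := v_dv_le k t.
  apply: (le_trans h); apply: (le_trans (key k t t8)).
  by apply: lerXn2r; rewrite ?nnegrE /M; lra.
- move=> k t t8; have [h _] := v_dv_le k t.
  apply: (le_trans h); rewrite /M exprMn; apply: ler_pM => //; last exact: key.
  exact: bound_ge0.
Qed.

(** Generating function form of [dvE]: multiplication by a power of [x * cos t] shifts the index of
    the series, so the sum over [i] becomes a product with [pL]. *)
Lemma first_integral_eq t x :
  Rbar_lt (Rabs x) (CV_radius (fun k => v k t)) ->
  Rbar_lt (Rabs x) (CV_radius (fun k => dv k t)) ->
  PSeries (fun k => dv k t) x =
  pL lam (x * cos t) *
    (sin t * cos t * PSeries (fun k => dv k t) x +
     sin t ^+ 2 * (x * PSeries (PS_derive (fun k => v k t)) x)).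
Proof.
move=> rv rdv.
pose B k := sin t * cos t * dv k t + sin t ^+ 2 * (k%:R * v k t).
have HB : is_pseries B x (sin t * cos t * PSeries (fun k => dv k t) x +
     sin t ^+ 2 * (x * PSeries (PS_derive (fun k => v k t)) x)).
  apply: (is_pseries_ext (PS_plus (PS_scal (sin t * cos t) (fun k => dv k t))
     (PS_scal (sin t ^+ 2) (PS_incr_1 (PS_derive (fun k => v k t)))))).
    case=> [|n]; rewrite /B /PS_plus /PS_scal /PS_incr_1 /PS_derive.
      by rewrite mul0r.
    by rewrite INRE.
  apply: is_pseries_plus.
    apply: is_pseries_scal; first exact: Rmult_comm.
    exact/PSeries_correct/CV_radius_inside.
  apply: is_pseries_scal; first exact: Rmult_comm.
  apply: is_pseries_incr_1.
  exact/PSeries_correct/ex_pseries_derive.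
apply: is_pseries_unique.
set b := _ + _ in HB *.
have := @is_pseries_sum _ (index_enum 'I_d)
  (fun i => PS_scal (lam i * cos t ^+ i.+1) (PS_incr_n B i.+1)) x
  (fun i => (lam i * cos t ^+ i.+1) * (x ^+ i.+1 * b)).
have -> : \sum_i lam i * cos t ^+ i.+1 * (x ^+ i.+1 * b) = pL lam (x * cos t) * b.
  rewrite /pL mulr_suml; apply: eq_bigr => i _.
  by rewrite RmultE exprMn; ring.
move=> X; apply: is_pseries_ext; last apply: X.
- move=> n; rewrite dvE [RHS]big_mkcond; apply: eq_bigr => i _.
  rewrite /PS_scal PS_incr_n_simplify.
  case: Compare_dec.le_lt_dec => h.
    have -> : (i < n)%N by lia.
    by [].
  have -> : (i < n)%N = false by lia.
  by rewrite -[RHS](mulr0 (lam i * cos t ^+ i.+1)).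
- move=> i; apply: is_pseries_scal; first exact: Rmult_comm.
  by rewrite -RpowE -pow_n_pow; exact: is_pseries_incr_n.
Qed.

Lemma pL_le x : `|x| <= 1 -> `|pL lam x| <= L * `|x|.
Proof.
move=> x1; rewrite /pL mulr_suml (le_trans (ler_norm_sum _ _ _)) //.
apply: ler_sum => i _; rewrite normrM ler_wpM2l // normrX exprS.
by rewrite ler_piMr // exprn_ile1.
Qed.

(** For such [x] the product with [pL] is at most [L] times the absolute value of [x], hence below
    1, and cannot cancel the -1. *)
Lemma polar_denominator_neq0 t x : `|x| <= (2 * (L + 1))^-1 ->
  -1 + sin t * cos t * pL lam (x * cos t) != 0.
Proof.
move=> hx; have L0 := L_ge0.
have den : 0 < 2 * (L + 1) by lra.
have x1 : `|x| * (2 * (L + 1)) <= 1 by rewrite -ler_pdivlMr // div1r.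
have xc : `|x * cos t| <= `|x| by rewrite normrM ler_piMr // normr_cos_le1.
have px : `|pL lam (x * cos t)| <= L * `|x|.
  have n0 := normr_ge0 x.
  by apply: le_trans (pL_le _) _; [nra | rewrite ler_wpM2l].
have scp : `|sin t * cos t * pL lam (x * cos t)| <= L * `|x|.
  rewrite normrM -[X in _ <= X]mul1r ler_pM // normrM.
  by rewrite mulr_ile1 ?normr_sin_le1 ?normr_cos_le1.
have : `|sin t * cos t * pL lam (x * cos t)| < 1.
  by have n0 := normr_ge0 x; apply: (le_lt_trans scp); nra.
by rewrite ltr_norml => /andP[_ h]; rewrite lt_eqF //; lra.
Qed.

(** With [A] for H_t and [B] for H_r, the left side is the slope of a level curve and the right side
    is [polarF]. *)
Lemma polar_slope (x P s c A B : R) :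
  A = P * (s * c * A + s ^+ 2 * (x * B)) -> B != 0 -> -1 + s * c * P != 0 ->
  - A / B = x * P * s ^+ 2 / (-1 + s * c * P).
Proof.
move=> E B0 D0; apply/eqP; rewrite eqr_div //; apply/eqP.
have E' : A - P * (s * c * A + s ^+ 2 * (x * B)) = 0 by rewrite -E subrr.
by rewrite -[RHS]add0r -E'; ring.
Qed.

(** Take level curves of [H] for [phi] and [H (2 * PI)] for [h]. As [H 0] is the identity near 0,
    the curve starting at [r0] stays on level [r0], and [h] maps its end back to [r0]. *)
Lemma inv_return_coeff_first_integral k : inv_return_coeff lam k (v k (2 * PI)).
Proof.
have [M [M0 vM dvM]] := v_dv_geometric.
have vM' n t : (Rabs t < 9%:R)%coqR -> (Rabs (v n t) <= pow M n)%coqR.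
  by move=> /RltP t8; apply/RleP; rewrite RpowE; exact: vM.
have dvM' n t : (Rabs t < 9%:R)%coqR -> (Rabs (dv n t) <= pow M n)%coqR.
  by move=> /RltP t8; apply/RleP; rewrite RpowE; exact: dvM.
have M0' : (0 < M)%coqR by apply/RltP.
have [K [K0 [Kt [Kr Krt]]]] := PSeries_param_bounds _ _ _ _ M0' v_derive vM' dvM'.
have [rho_gt0 rho_lt] := rho_lt _ M0'.
set rho := Rinv _ in rho_gt0 rho_lt Kt Kr Krt.
pose H t := PSeries (fun k => v k t).
pose Hr t := PSeries (PS_derive (fun k => v k t)).
pose Ht t := PSeries (fun k => dv k t).
(* Small enough both for convergence and for a nonzero polar denominator. *)
pose rho1 := Num.min rho (2 * (L + 1))^-1.
have L1 : 0 < (2 * (L + 1))^-1 by rewrite invr_gt0; have := L_ge0; lra.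
have rho1_gt0 : 0 < rho1 by rewrite lt_min L1 andbT; exact/RltP.
have rho1_le x : (Rabs x <= rho1)%coqR -> (Rabs x <= rho)%coqR.
  by move=> /RleP h; apply/RleP/(le_trans h); rewrite /rho1 ge_min lexx.
have [delta [phi [delta_gt0 phiP]]] := @implicit_function H Hr Ht 9%:R rho1 K
  (elimT RltP rho1_gt0) K0
  (fun t r t8 r1 => is_derive_PSeries _ _ (CV_radius_v _ _ _ M0' vM' _ _ t8 (rho1_le r r1)))
  (fun t r t8 r1 => is_derive_PSeries_param _ _ _ _ M0' v_derive vM' dvM' _ _ t8 (rho1_le r r1))
  (fun t r t8 r1 => Kt t r t8 (rho1_le r r1))
  (fun t x y t8 x1 y1 => Kr t x y t8 (rho1_le x x1) (rho1_le y y1))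
  (fun t s x t8 s8 x1 => Krt t s x t8 s8 (rho1_le x x1))
  (fun t => etrans (PSeries_0 _) (v0 t))
  (fun t => etrans (PSeries_0 _) (etrans (Rmult_1_l _) (v1 t))).
have PI0 : 0 < PI by apply/RltP/PI_RGT_0.
have PI9 : 2 * PI < 9.
  have : PI <= 4 by apply/RleP; rewrite -[4]INRE; move: PI_4; rewrite [INR 4]INR_IZR_INZ.
  lra.
have lt9 (t : R) : 0 <= t <= 2 * PI -> (Rabs t < 9%:R)%coqR.
  by move=> ht; apply/RltP; rewrite RabsE ger0_norm; lra.
have h0 : (0 : R)%R <= (0 : R)%R <= 2 * PI by rewrite lexx mulr_ge0 // ltW.
have h2 : 0 <= 2 * PI <= 2 * PI by lra.
exists delta, phi, (H (2 * PI)); split; first exact/RltP.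
split; last split.
- move=> r0 /RltP r0d; split.
    have [_ [_ [_ [phi_uniq _]]]] := phiP 0 r0 (lt9 0 h0) r0d.
    apply: phi_uniq => //.
    (* At angle 0 only [v 1] survives, so the series is the constant 1 shifted by one index. *)
    rewrite /H; apply: is_pseries_unique.
    pose u (k : nat) : R := if k is 0%N then 1 else 0.
    apply: (is_pseries_ext (PS_incr_1 u)).
      by case=> [|[|n]]; rewrite ?v0 ?v1 ?v_init.
    have : is_pseries u r0 1.
      apply: (filterlim_ext (fun=> 1)); last exact: filterlim_const.
      elim=> [|n IHn]; first by rewrite sum_O scal_one.
      by rewrite sum_Sn -IHn (scal_zero_r (V := R_NormedModule)) plus_zero_r.
    by move=> /is_pseries_incr_1; rewrite [scal r0 _]Rmult_1_r.
  move=> th /lt9 th9.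
  have [phi_le [_ [Hr_ge [_ phi_der]]]] := phiP th r0 th9 r0d.
  set x := phi th r0 in phi_le Hr_ge phi_der *.
  have E := first_integral_eq (CV_radius_v _ _ _ M0' vM' _ _ th9 (rho1_le x phi_le))
    (CV_radius_dv _ _ _ M0' dvM' _ _ th9 (rho1_le x phi_le)).
  suff <- : (- Ht th x / Hr th x)%coqR = polarF lam th x by [].
  rewrite RdivE; apply: polar_slope.
  + exact: E.
  + by apply/eqP => Hr0; move: Hr_ge; rewrite Hr0 => /RleP; rewrite !RealsE /=; lra.
  + apply: polar_denominator_neq0.
    by move/RleP: phi_le; rewrite /rho1 le_min => /andP[].
- move=> r0 /RltP r0d.
  by have [_ [Hphi _]] := phiP (2 * PI) r0 (lt9 _ h2) r0d.
- rewrite Derive_n_coef; last first.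
    have := CV_radius_v _ _ _ M0' vM' _ 0 (lt9 _ h2); rewrite Rabs_R0; apply.
    exact: Rlt_le.
  rewrite factE mulfK // INRE pnatr_eq0 -lt0n fact_gt0 //.
Qed.

End FirstIntegral.

(** * Coefficients of the first integral *)

Lemma continuous_sum (I : Type) (s : seq I) (P : pred I) (f : I -> R -> R) (x : R) :
  (forall i, P i -> continuous (f i) x) ->
  continuous (fun t => \sum_(i <- s | P i) f i t) x.
Proof.
move=> cf; elim: s => [|i s IHs].
  by apply: (continuous_ext (fun=> 0%coqR)) => [t|]; [rewrite big_nil | exact: continuous_const].
case: (boolP (P i)) => Pi.
  apply: (continuous_ext (fun t => f i t + \sum_(i <- s | P i) f i t)) => [t|].
    by rewrite big_cons Pi.
  by apply: (continuous_plus (V := R_NormedModule)); [exact: cf | exact: IHs].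
apply: continuous_ext IHs => t.
by rewrite big_cons (negbTE Pi).
Qed.

Lemma continuous_exprn (f : R -> R) (n : nat) (x : R) :
  continuous f x -> continuous (fun t => f t ^+ n) x.
Proof.
move=> cf; elim: n => [|n IHn]; first exact: continuous_const.
apply: (continuous_ext (fun t => f t * f t ^+ n)) => [t|]; first by rewrite exprS.
exact: (continuous_mult (K := R_AbsRing)).
Qed.

Lemma is_derive_sum (I : Type) (s : seq I) (P : pred I) (f df : I -> R -> R) (x : R) :
  (forall i, P i -> is_derive (f i) x (df i x)) ->
  is_derive (fun t => \sum_(i <- s | P i) f i t) x (\sum_(i <- s | P i) df i x).
Proof.
move=> Hf; elim: s => [|i s IHs].
  rewrite big_nil; apply: (is_derive_ext (fun=> 0%coqR)) => [t|]; first by rewrite big_nil.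
  exact: is_derive_const.
rewrite big_cons; case: ifP => Pi; last first.
  by apply: is_derive_ext IHs => t; rewrite big_cons Pi.
apply: (is_derive_ext (fun t => f i t + \sum_(i <- s | P i) f i t)) => [t|].
  by rewrite big_cons Pi.
by apply: (is_derive_plus (V := R_NormedModule)); [exact: Hf | exact: IHs].
Qed.

Section Coefficients.

Variable d : nat.
Implicit Types (m : 'X_{1..d}) (t : R) (i : 'I_d).

(* [coef m] is the coefficient of ['X_[m]] in [v_k], where [k = (mnmwgt m).+1],
   and [slope m] is its derivative; the fuel of [slope_rec] is [mdeg m]. *)
Fixpoint slope_rec (n : nat) (m : 'X_{1..d}) (t : R) : R :=
  if n is n'.+1 then
    (\sum_(i < d | (U_(i) <= m)%MM) cos t ^+ i.+1 *
      (sin t * cos t * slope_rec n' (m - U_(i))%MM t + sin t ^+ 2 *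
        ((mnmwgt (m - U_(i))%MM).+1%:R *
          ((m - U_(i) == 0)%MM%:R + RInt (slope_rec n' (m - U_(i))%MM) 0 t))))%R
  else 0.

Definition slope m : R -> R := slope_rec (mdeg m) m.

Definition coef m t : R := ((m == 0%MM)%:R + RInt (slope m) 0 t)%R.

Arguments slope m _%_ring_scope.
Arguments coef m t%_ring_scope.

Lemma mdegBU m i : (U_(i) <= m)%MM -> (mdeg (m - U_(i))%MM).+1 = mdeg m.
Proof. by move=> im; rewrite -{2}(submK im) mdegD mdeg1 addn1. Qed.

Lemma mnmwgtBU m i : (U_(i) <= m)%MM -> (mnmwgt (m - U_(i))%MM + i.+1 = mnmwgt m)%N.
Proof. by move=> im; rewrite -{2}(submK im) mnmwgtD mnmwgt1. Qed.

(** Removing a variable lowers the degree by one, so the fuel left for each summand is exactly its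
    degree. *)
Lemma slopeE m t : slope m t =
  \sum_(i < d | (U_(i) <= m)%MM) cos t ^+ i.+1 *
    (sin t * cos t * slope (m - U_(i))%MM t +
     sin t ^+ 2 * ((mnmwgt (m - U_(i))%MM).+1%:R * coef (m - U_(i))%MM t)).
Proof.
rewrite {1}/slope; case E: (mdeg m) => [|n] /=.
  by rewrite big_pred0 // => i; apply/negP => /mdegBU; rewrite E.
apply: eq_bigr => i im; rewrite /coef /slope.
by have := mdegBU im; rewrite E => -[->].
Qed.

Lemma is_derive_coef_of_continuous m : (forall t, continuous (slope m) t) ->
  forall t, is_derive (coef m) t (slope m t).
Proof.
move=> cm t; rewrite -[X in is_derive _ _ X](plus_zero_l (slope m t)).
apply: (is_derive_plus (V := R_NormedModule)); first exact: is_derive_const.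
apply: (is_derive_RInt (V := R_NormedModule) (slope m) (RInt (slope m) 0) 0 t) => //.
apply: filter_forall => b; apply: RInt_correct.
by apply: ex_RInt_continuous => z _; exact: cm.
Qed.

(** Induction on the degree: [slope m] is built from coefficients of smaller degree, which are
    integrals of continuous slopes. Hence the previous lemma takes continuity as a hypothesis. *)
Lemma continuous_slope m t : continuous (slope m) t.
Proof.
elim: (mdeg m) {-2}m (erefl (mdeg m)) t => [|n IHn] {}m En t.
  apply: (continuous_ext (fun=> 0%coqR)) => [s|]; last exact: continuous_const.
  by rewrite /slope En.
apply: (continuous_ext _ _ _ (fun s => esym (slopeE m s))).
apply: continuous_sum => i im.
have Ei : mdeg (m - U_(i))%MM = n by have := mdegBU im; rewrite En => -[].
have cs := continuous_sin t; have cc := continuous_cos t.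
have cI := IHn _ Ei.
have cD : continuous (coef (m - U_(i))%MM) t.
  apply: (ex_derive_continuous (V := R_NormedModule)).
  by eexists; exact: is_derive_coef_of_continuous.
apply: (continuous_mult (K := R_AbsRing)); first exact: continuous_exprn.
apply: (continuous_plus (V := R_NormedModule)).
  apply: (continuous_mult (K := R_AbsRing)); last exact: cI.
  exact: (continuous_mult (K := R_AbsRing)).
apply: (continuous_mult (K := R_AbsRing)); first exact: continuous_exprn.
by apply: (continuous_mult (K := R_AbsRing)); first exact: continuous_const.
Qed.

Lemma is_derive_coef m t : is_derive (coef m) t (slope m t).
Proof. by apply: is_derive_coef_of_continuous => s; exact: continuous_slope. Qed.

Lemma coef_at0 m : coef m 0 = (m == 0%MM)%:R.
Proof. by rewrite /coef RInt_point [LHS]addr0. Qed.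

Lemma slope0 t : slope 0%MM t = 0.
Proof. by rewrite /slope mdeg0. Qed.

Lemma coef0 t : coef 0%MM t = 1.
Proof.
rewrite /coef eqxx (RInt_ext _ (fun=> 0%coqR)) => [|x _]; last exact: slope0.
by rewrite RInt_const [scal _ _]Rmult_0_r addr0.
Qed.

(** Bounding the degree by [k] only makes the index set finite: degree is at most weight, so no
    monomial of weight [k - 1] is lost. *)
Definition wpart (k : nat) (F : 'X_{1..d} -> R) : {mpoly R[d]} :=
  \sum_(m : 'X_{1..d < k} | (mnmwgt m).+1 == k) F m *: 'X_[m].

Lemma mcoeff_wpart k F m :
  (wpart k F)@_m = if (mnmwgt m).+1 == k then F m else 0.
Proof.
rewrite /wpart raddf_sum /=.
case: ifPn => [/eqP wk|nk].
  have mk : (mdeg m < k)%N by rewrite -wk ltnS leq_mdeg_mnmwgt.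
  rewrite (bigD1 (BMultinom mk)) /=; last by rewrite wk.
  rewrite mcoeffZ mcoeffX eqxx mulr1 big1 ?addr0 // => m' /andP[_ ne].
  rewrite mcoeffZ mcoeffX; case: eqP => [e|]; last by rewrite mulr0.
  by case/eqP: ne; apply: val_inj.
rewrite big1 // => m' /eqP wm'; rewrite mcoeffZ mcoeffX.
case: eqP => [e|]; last by rewrite mulr0.
by rewrite -e wm' eqxx in nk.
Qed.

Lemma mcoeffMXU (p : {mpoly R[d]}) i m :
  ('X_i * p)@_m = if (U_(i) <= m)%MM then p@_(m - U_(i))%MM else 0.
Proof.
rewrite -commr_mpolyX; case: ifPn => im.
  by rewrite -{1}(submK im) addmC mcoeffMX.
apply/eqP; rewrite mcoeff_eq0 (perm_mem (msuppMX _ _)).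
by apply: contra im => /mapP[m' _ ->]; exact: lem_addr.
Qed.

(** ['X_i] has weight [i + 1], so the recursion on coefficients reassembles into [dvE] before
    evaluation at [lam]. *)
Lemma wpart_slope k t : wpart k (slope^~ t) =
  \sum_(i < d | (i < k)%N) cos t ^+ i.+1 *: ('X_i *
    ((sin t * cos t) *: wpart (k - i.+1) (slope^~ t) +
     (sin t ^+ 2 * (k - i.+1)%:R) *: wpart (k - i.+1) (coef^~ t))).
Proof.
apply/mpolyP => m; rewrite mcoeff_wpart raddf_sum /=.
transitivity (\sum_(i < d) if (i < k)%N && (U_(i) <= m)%MM && ((mnmwgt m).+1 == k) then
   cos t ^+ i.+1 * (sin t * cos t * slope (m - U_(i))%MM t +
     sin t ^+ 2 * ((mnmwgt (m - U_(i))%MM).+1%:R * coef (m - U_(i))%MM t)) else 0).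
  case: eqP => wk; last by rewrite big1 // => i _; rewrite andbF.
  rewrite slopeE big_mkcond; apply: eq_bigr => i _; rewrite andbT.
  case: ifP => im; last by rewrite andbF.
  by have -> : (i < k)%N by have := mnmwgtBU im; lia.
rewrite [RHS]big_mkcond; apply: eq_bigr => i _.
case: (boolP (i < k)%N) => //= ik.
rewrite mcoeffZ mcoeffMXU; case: (boolP (U_(i) <= m)%MM) => im /=; last by rewrite mulr0.
rewrite mcoeffD !mcoeffZ !mcoeff_wpart.
have := mnmwgtBU im.
have -> : ((mnmwgt m).+1 == k) = ((mnmwgt (m - U_(i))%MM).+1 == k - i.+1)%N.
  by have := mnmwgtBU im; lia.
case: eqP => [<- _|_ _]; last by rewrite !mulr0 addr0 mulr0.
by ring.
Qed.

Lemma meval_wpart k F (lam : 'I_d -> R) : (wpart k F).@[lam] =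
  \sum_(m : 'X_{1..d < k} | (mnmwgt m).+1 == k) F m * ('X_[m] : {mpoly R[d]}).@[lam].
Proof. by rewrite raddf_sum /=; apply: eq_bigr => m _; rewrite mevalZ. Qed.

Definition return_poly (k : nat) : {mpoly R[d]} := wpart k (coef^~ (2 * PI)%R).

Lemma wpart0 F : wpart 0 F = 0.
Proof. by apply/mpolyP => m; rewrite mcoeff_wpart mcoeff0. Qed.

Lemma wpart1 F : wpart 1 F = (F 0%MM)%:MP.
Proof.
apply/mpolyP => m; rewrite mcoeff_wpart mcoeffC eqSS.
case: (eqVneq m 0%MM) => [->|m0]; first by rewrite mnmwgt0 mulr1.
rewrite mulr0 ifN // -leqn0 -ltnNge.
by apply: leq_trans (leq_mdeg_mnmwgt m); rewrite lt0n mdeg_eq0.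
Qed.

Lemma inv_return_coeff_poly (lam : 'I_d -> R) k :
  inv_return_coeff lam k (return_poly k).@[lam].
Proof.
apply: (@inv_return_coeff_first_integral d lam
  (fun k t => (wpart k (coef^~ t)).@[lam]) (fun k t => (wpart k (slope^~ t)).@[lam])).
- move=> {}k t; rewrite meval_wpart.
  apply: (is_derive_ext (fun s => \sum_(m : 'X_{1..d < k} | (mnmwgt m).+1 == k)
     coef m s * ('X_[m] : {mpoly R[d]}).@[lam])) => [s|]; first by rewrite meval_wpart.
  apply: (@is_derive_sum _ _ _ _ (fun (m : 'X_{1..d < k}) s => slope m s * ('X_[m] : {mpoly R[d]}).@[lam])) => m _.
  exact/(is_derive_scal_l (V := R_NormedModule))/is_derive_coef.
- by move=> t; rewrite wpart0 meval0.
- by move=> t; rewrite wpart1 mevalC coef0.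
(* Only the monomial 1 has a nonzero coefficient at angle 0, and its weight 0 excludes it when
   [k >= 2]. *)
- move=> {}k k2; rewrite meval_wpart big1 // => m /eqP wm.
  rewrite coef_at0; case: eqP => [m0|]; last by rewrite mul0r.
  by exfalso; move: wm k2; rewrite m0 mnmwgt0 => <-.
- move=> {}k t; rewrite {1}wpart_slope raddf_sum /=; apply: eq_bigr => i _.
  by rewrite mevalZ mevalM mevalXU mevalD !mevalZ; ring.
Qed.

(* With only odd powers in [p] the system is reversible under [x -> -x], i.e.
   under [t -> PI - t]. *)
Lemma coef_reversible m : (forall i, odd i -> m i = 0%N) ->
  forall t, [/\ slope m (PI - t) = - slope m t, slope m (t + 2 * PI) = slope m t,
    coef m (PI - t) = coef m t & coef m (t + 2 * PI) = coef m t].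
Proof.
elim: (mdeg m) {-2}m (erefl (mdeg m)) => [|n IHn] {}m En odd0.
  have -> : m = 0%MM by apply/eqP; rewrite -mdeg_eq0 En.
  by move=> t; rewrite !slope0 !coef0 oppr0.
have trig t : [/\ cos (PI - t)%R = - cos t, sin (PI - t)%R = sin t,
    cos (t + 2 * PI)%R = cos t & sin (t + 2 * PI)%R = sin t].
  by have [c1 [s1 [c2 s2]]] := trig_reversible t; split.
have IH i : (U_(i) <= m)%MM -> forall t,
  [/\ slope (m - U_(i))%MM (PI - t) = - slope (m - U_(i))%MM t,
      slope (m - U_(i))%MM (t + 2 * PI) = slope (m - U_(i))%MM t,
    coef (m - U_(i))%MM (PI - t) = coef (m - U_(i))%MM t &
    coef (m - U_(i))%MM (t + 2 * PI) = coef (m - U_(i))%MM t].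
  move=> im; apply: IHn; first by have := mdegBU im; rewrite En => -[].
  by move=> j oj; rewrite mnmBE odd0.
have ev i : (U_(i) <= m)%MM -> ~~ odd i.
  by rewrite lep1mP; apply: contra => /odd0 ->.
(* The odd power [i.+1] of the cosine gives the sign; inside, the signs of the cosine and of the
   smaller slope cancel. *)
have S1 t : slope m (PI - t) = - slope m t.
  rewrite !slopeE -sumrN; apply: eq_bigr => i im.
  have [-> -> _ _] := trig t; have [-> _ -> _] := IH i im t.
  by rewrite exprNn -signr_odd /= (negbTE (ev i im)) /=; ring.
have S2 t : slope m (t + 2 * PI) = slope m t.
  rewrite !slopeE; apply: eq_bigr => i im.
  by have [_ _ -> ->] := trig t; have [_ -> _ ->] := IH i im t.
(* The difference is constant by [S1] and vanishes at the fixed point [PI / 2] of the reflection. *)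
have C1 t : coef m (PI - t) = coef m t.
  suff E : coef m (PI - t) - coef m t = coef m (PI - PI / 2) - coef m (PI / 2).
    apply/eqP; rewrite -subr_eq0 E; apply/eqP.
    by rewrite (_ : PI - PI / 2 = PI / 2) ?subrr //; field.
  apply: (eq_derive0 (fun s : R => coef m (PI - s) - coef m s)) => s.
  have := is_derive_minus (V := R_NormedModule) _ _ _ _ _
    (is_derive_comp_sub _ _ PI s (is_derive_coef m)) (is_derive_coef m s).
  rewrite [minus _ _](_ : _ = 0) //.
  by rewrite -[(PI - s)%coqR]/(PI - s) S1 /minus /plus /opp /= !RoppE RplusE opprK subrr.
(* The difference is constant by [S2]. At [- (PI / 2)] the reflection exchanges the two arguments,
   so [C1] makes it zero. *)
have C2 t : coef m (t + 2 * PI) = coef m t.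
  suff E : coef m (t + 2 * PI) - coef m t =
      coef m (- (PI / 2) + 2 * PI) - coef m (- (PI / 2)).
    apply/eqP; rewrite -subr_eq0 E -(C1 (- (PI / 2))) subr_eq0; apply/eqP.
    by congr coef; field.
  apply: (eq_derive0 (fun s : R => coef m (s + 2 * PI) - coef m s)) => s.
  have := is_derive_minus (V := R_NormedModule) _ _ _ _ _
    (is_derive_comp_add _ _ (2 * PI) s (is_derive_coef m)) (is_derive_coef m s).
  by rewrite -[(s + 2 * PI)%coqR]/(s + 2 * PI) S2 minus_eq_zero.
by move=> t; split.
Qed.

Lemma coef_2PI_eq0 m : m != 0%MM -> (forall i, odd i -> m i = 0%N) ->
  coef m (2 * PI)%R = 0.
Proof.
move=> m0 odd0; have [_ _ _] := coef_reversible odd0 0.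
by rewrite add0r coef_at0 (negbTE m0).
Qed.

Lemma slopeU i t : slope U_(i)%MM t = cos t ^+ i.+1 * sin t ^+ 2.
Proof.
rewrite slopeE (big_pred1 i) => [|j].
  have -> : (U_(i) - U_(i) = 0 :> 'X_{1..d})%MM by apply/mnmP => j; rewrite mnmBE subnn mnm0E.
  by rewrite slope0 coef0 mnmwgt0 !mulr0 add0r !mulr1.
by rewrite lep1mP mnm1E /= [i == j]eq_sym; case: (j == i).
Qed.

Lemma coef_U_2PI_gt0 i : odd i -> 0 < coef U_(i)%MM (2 * PI).
Proof.
move=> oi; rewrite /coef mnm1_eq0 add0r.
(* For odd [i], [2 * uphalf i] is [i + 1]. *)
rewrite (RInt_ext _ (fun t => pow (cos t) (2 * (uphalf i)) * pow (sin t) 2)%coqR).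
  exact/RltP/RInt_cos_sin2_gt0.
by move=> t _; rewrite slopeU !RpowE RmultE; congr (_ ^+ _ * _); lia.
Qed.

End Coefficients.

(** * The Bautin ideals *)

Section Ideals.

Variable d : nat.
Implicit Types (gs : seq {mpoly R[d]}) (p q g : {mpoly R[d]}) (m : 'X_{1..d}).

(** Coefficients given by a function carry no length condition, which eases sums and products. *)
Lemma ideal_genP gs p :
  ideal_gen gs p <-> exists c : nat -> {mpoly R[d]}, p = \sum_(i < size gs) c i * gs`_i.
Proof.
split=> [[cs [_ ->]]|[c ->]]; first by exists (fun i => cs`_i).
exists (mkseq c (size gs)); rewrite size_mkseq; split=> //.
by apply: eq_bigr => i _; rewrite nth_mkseq.
Qed.

Lemma ideal_gen0 gs : ideal_gen gs 0.
Proof. by apply/ideal_genP; exists (fun=> 0); rewrite big1 // => i _; rewrite mul0r. Qed.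

Lemma ideal_genD gs p q : ideal_gen gs p -> ideal_gen gs q -> ideal_gen gs (p + q).
Proof.
move=> /ideal_genP[a ->] /ideal_genP[b ->]; apply/ideal_genP.
exists (fun i => a i + b i); rewrite -big_split; apply: eq_bigr => i _ /=.
by rewrite mulrDl.
Qed.

Lemma ideal_genM gs p q : ideal_gen gs q -> ideal_gen gs (p * q).
Proof.
move=> /ideal_genP[b ->]; apply/ideal_genP.
by exists (fun i => p * b i); rewrite mulr_sumr; apply: eq_bigr => i _; rewrite mulrA.
Qed.

Lemma ideal_gen_sum gs (I : eqType) (s : seq I) (F : I -> {mpoly R[d]}) :
  (forall i, i \in s -> ideal_gen gs (F i)) -> ideal_gen gs (\sum_(i <- s) F i).
Proof.
move=> H; rewrite big_seq.
by apply: big_ind => //; [exact: ideal_gen0 | move=> ? ?; exact: ideal_genD].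
Qed.

Lemma mem_ideal_gen gs g : g \in gs -> ideal_gen gs g.
Proof.
move=> gg; apply/ideal_genP; exists (fun i => (i == index g gs)%:R).
have ig : (index g gs < size gs)%N by rewrite index_mem.
rewrite (bigD1 (Ordinal ig)) //= eqxx mul1r nth_index // big1 ?addr0 // => i.
by rewrite -val_eqE /= => /negbTE ->; rewrite mul0r.
Qed.

Lemma ideal_gen_trans gs hs p :
  (forall g, g \in gs -> ideal_gen hs g) -> ideal_gen gs p -> ideal_gen hs p.
Proof.
move=> H /ideal_genP[c ->]; apply: ideal_gen_sum => i _.
by apply: ideal_genM; apply: H; exact: mem_nth.
Qed.

(** Each term of [p] is a multiple of a variable in [gs], so membership is checked term by term. *)
Lemma ideal_gen_monomials gs p :
  (forall m, p@_m != 0 -> exists2 i : 'I_d, 'X_i \in gs & (U_(i) <= m)%MM) ->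
  ideal_gen gs p.
Proof.
move=> H; rewrite [p]mpolyE; apply: ideal_gen_sum => m.
rewrite mcoeff_msupp => /H[i ig im].
rewrite -(submK im) mpolyXD scalerAl.
exact/ideal_genM/mem_ideal_gen.
Qed.

(** Even subscripts of lambda are odd ordinals; for [n = d./2] this is [even_gens d]. *)
Definition gens (n : nat) : seq {mpoly R[d]} := [seq lamX d (2 * j).+1 | j <- iota 0 n].

Lemma lamX_ord (i : 'I_d) : lamX d i = 'X_i.
Proof. by rewrite /lamX valK. Qed.

Lemma mem_gens n (i : 'I_d) : odd i -> (i < 2 * n)%N -> 'X_i \in gens n.
Proof.
move=> oi lti; rewrite -lamX_ord; apply/mapP; exists (i./2).
  by rewrite mem_iota; lia.
by congr lamX; lia.
Qed.

Lemma size_gens n : size (gens n) = n.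
Proof. by rewrite size_map size_iota. Qed.

Lemma nth_gens n j : (j < n)%N -> (gens n)`_j = lamX d (2 * j).+1.
Proof. by move=> jn; rewrite (nth_map 0%N) ?size_iota // nth_iota. Qed.

Lemma gens_sub n n' g : (n <= n')%N -> g \in gens n -> g \in gens n'.
Proof.
move=> le /mapP[j jn ->]; apply/mapP; exists j => //.
by move: jn; rewrite !mem_iota; lia.
Qed.

(** Homogeneity gives the weight. Reversibility gives the variable: a nontrivial monomial in even
    ordinals alone has coefficient 0 at [2 * PI]. *)
Lemma mcoeff_return_poly_neq0 k m : (2 <= k)%N -> (return_poly d k)@_m != 0 ->
  (mnmwgt m).+1 = k /\ exists2 i : 'I_d, odd i & (U_(i) <= m)%MM.
Proof.
move=> k2; rewrite mcoeff_wpart; case: (eqVneq (mnmwgt m).+1 k) => [wm|_]; last by rewrite eqxx.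
move=> c0; split=> //.
have m0 : m != 0%MM by apply/eqP => m0; move: wm k2; rewrite m0 mnmwgt0 => <-.
case: (pickP (fun i : 'I_d => odd i && (U_(i) <= m)%MM)) => [i /andP[]|none].
  by exists i.
case/eqP: c0; apply: coef_2PI_eq0 => // i oi.
by have := none i; rewrite oi lep1mP /= => /negbT; rewrite negbK => /eqP.
Qed.

Lemma mnmwgt_ge m (i : 'I_d) : (U_(i) <= m)%MM -> (i.+1 <= mnmwgt m)%N.
Proof. by move/mnmwgtBU => <-; rewrite leq_addl. Qed.

(** The weight limits which generators can occur in each [return_poly]. Conversely the relation is
    triangular: each new generator appears linearly, with positive coefficient, modulo the earlier
    ones. *)
Lemma I_k_gens k p : (2 <= k)%N ->
  I_k (return_poly d) k p <-> ideal_gen (gens (minn d./2 k.-1./2)) p.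
Proof.
move=> k2; split; apply: ideal_gen_trans => g.
  move=> /mapP[j]; rewrite mem_iota => jk ->.
  apply: ideal_gen_monomials => m /mcoeff_return_poly_neq0[|wm [i oi im]]; first by lia.
  exists i => //; apply: mem_gens => //.
  have := mnmwgt_ge im; have := ltn_ord i; move: jk oi wm.
  rewrite /minn; case: ifP; lia.
move=> /mapP[j jn ->] {g p}; move: jn; rewrite mem_iota /= add0n.
elim/ltn_ind: j => j IH jn.
have jd : ((2 * j).+1 < d)%N by move: jn; rewrite leq_min; lia.
pose o := Ordinal jd.
have oo : odd o by rewrite /=; lia.
have -> : lamX d (2 * j).+1 = 'X_o by rewrite -lamX_ord.
set c := coef U_(o)%MM (2 * PI)%R.
have c0 : c != 0 by rewrite gt_eqF // coef_U_2PI_gt0.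
(* ['X_o] has weight [2 * j + 2], one less than this index. *)
pose V := return_poly d (2 * j).+3.
have Vin : ideal_gen [seq return_poly d i | i <- iota 2 (k - 1)] V.
  apply: mem_ideal_gen; apply: map_f.
  by rewrite mem_iota; move: jn; rewrite leq_min; lia.
(* A monomial divisible by ['X_o] has no weight left for anything else, so it is the subtracted one.
   Every other monomial contains an earlier generator. *)
have qin : ideal_gen [seq return_poly d i | i <- iota 2 (k - 1)] (V - c *: 'X_o).
  apply: (@ideal_gen_trans (gens j)) => [g /mapP[l lj ->]|].
    by move: lj; rewrite mem_iota => lj; apply: IH; lia.
  apply: ideal_gen_monomials => m; rewrite mcoeffB mcoeffZ mcoeffX.
  case: (eqVneq U_(o)%MM m) => [<-|mo].
    by rewrite mcoeff_wpart mnmwgt1 eqxx mulr1 subrr eqxx.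
  rewrite mulr0 subr0 => /mcoeff_return_poly_neq0[//|wm [i oi im]].
  exists i => //; apply: mem_gens => //.
  have := mnmwgt_ge im.
  case: (eqVneq i o) => [io|]; last by rewrite -val_eqE /=; lia.
  have := mnmwgtBU im; have := leq_mdeg_mnmwgt (m - U_(i))%MM; rewrite io /= => h1 h2.
  have : mdeg (m - U_(o))%MM == 0%N by lia.
  rewrite mdeg_eq0 => /eqP z; case/eqP: mo.
  by rewrite -[RHS](submK (m := U_(o)%MM)) -?io // io z add0m.
have -> : 'X_o = c^-1%:MP * (V + (-1) * (V - c *: 'X_o)).
  rewrite mulN1r opprB addrC subrK mul_mpolyC scalerA mulVf // scale1r //.
by apply: ideal_genM; apply: ideal_genD => //; exact: ideal_genM.
Qed.

(** Evaluate where this variable is 1 and all others are 0: every element of [gens n] vanishes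
    there. *)
Lemma lamX_notin_gens n n' : (n < n' <= d./2)%N -> ~ ideal_gen (gens n) (lamX d (2 * n'.-1).+1).
Proof.
move=> nn /ideal_genP[c].
have nd : ((2 * n'.-1).+1 < d)%N by lia.
rewrite (lamX_ord (Ordinal nd)).
move/(congr1 (meval (fun i : 'I_d => (i == Ordinal nd)%:R : R))).
rewrite mevalXU eqxx raddf_sum big1 => [/eqP|i _]; first by rewrite oner_eq0.
rewrite /= mevalM.
have i_lt : (i < n)%N by rewrite -[X in (_ < X)%N](size_gens n).
rewrite nth_gens //.
have id : ((2 * i).+1 < d)%N by lia.
rewrite (lamX_ord (Ordinal id)) mevalXU -val_eqE /=.
have -> : ((2 * i).+1 == (2 * n'.-1).+1) = false by lia.
by rewrite mulr0.
Qed.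

End Ideals.

Theorem theorem1p3 (d : nat) (hd : (2 <= d)%N) :
  exists V : nat -> {mpoly R[d]},
    (forall k, (2 <= k)%N -> forall lam : 'I_d -> R,
        inv_return_coeff lam k (V k).@[lam]) /\
    (forall p, Bautin_ideal V p <-> ideal_gen (even_gens d) p) /\
    is_Bautin_index V (2 * d./2 + 1).
Proof.
exists (return_poly d); split; first by move=> k _ lam; exact: inv_return_coeff_poly.
have n0 : (0 < d./2)%N by lia.
split=> [p|].
  split=> [[k [k2 /(I_k_gens _ k2)]]|Hp].
    by apply: ideal_gen_trans => g /(gens_sub (geq_minl _ _)); exact: mem_ideal_gen.
  (* This is the first index [k] for which [k.-1./2] reaches [d./2]. *)
  exists (2 * d./2 + 1)%N; split; first by lia.
  apply/I_k_gens; first by lia.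
  by rewrite (_ : minn _ _ = d./2) //; lia.
split; first by lia.
split=> [j jk p|k k2 kB stab].
  rewrite !I_k_gens; try lia.
  have -> : minn d./2 j.-1./2 = d./2 by lia.
  by have -> : minn d./2 (2 * d./2 + 1).-1./2 = d./2 by lia.
(* Stabilization at an earlier [k] would put the last generator in the ideal of strictly earlier
   ones. *)
have : ideal_gen (gens d (minn d./2 k.-1./2)) (lamX d (2 * (d./2).-1).+1).
  apply/(I_k_gens _ k2)/(stab (2 * d./2 + 1)%N (ltnW kB)).
  apply/I_k_gens; first by lia.
  apply: mem_ideal_gen; apply: map_f; rewrite mem_iota; lia.
by apply: lamX_notin_gens; lia.
Qed.
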